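(* Let $\mathbb{F}$ be a finite field, $n\ge 1$ with $\mathrm{char}(\mathbb{F})\nmid n$, $A=\mathbb{F}[x]/\langle x^n-1\rangle$, $\sigma\in\mathrm{Aut}_{\mathbb{F}}(A)$, and let $E=\{\varepsilon^{(0)},\ldots,\varepsilon^{(r-1)}\}$ be the set of primitive idempotents of $A$. Let $S\subset E$ be a nonempty subset and $b\ge 1$ an integer such that $S\cap\sigma^j(S)=\varnothing$ for all $1\le j\le b$. Put $c:=\sum_{\varepsilon\in S}\varepsilon$, $k:=\dim_{\mathbb{F}}\langle c\rangle$, let $1\le m\le b$, and let $$g:=c\sum_{\nu=0}^m z^\nu=\sum_{\nu=0}^m z^\nu\sigma^\nu(c)\in A[z;\sigma],\qquad G:=\sum_{\nu=0}^m z^\nu G_\nu\in\mathbb{F}[z]^{k\times n},$$ where $G_\nu\in\mathbb{F}^{k\times n}$ has rows $\mathfrak{v}(\sigma^\nu(c)),\mathfrak{v}(\sigma^\nu(xc)),\ldots,\mathfrak{v}(\sigma^\nu(x^{k-1}c))$. Then: (a) $g=c\,(1+z\sigma(c))(1+z\sigma^2(c))\cdots(1+z\sigma^m(c))$. (b) $gu=c$, where $u=(1-z\sigma^m(c))(1-z\sigma^{m-1}(c))\cdots(1-z\sigma(c))$. Furthermore, $u$ is a unit in $A[z;\sigma]$ and $u=1-z\big(\sigma(c)+\cdots+\sigma^m(c)\big)$. (c) Let $\mathcal{C}:=\mathrm{im}\,G$. Then $\mathcal{C}=\mathfrak{v}(\{fg\mid f\in A[z;\sigma]\})$. Thus $\mathcal{C}$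 is a ($\sigma$-)cyclic submodule of $\mathbb{F}[z]^n$. Moreover, $\mathrm{rank}\,\mathcal{C}=k$. (d) $\mathcal{C}$ is a ($\sigma$-)cyclic convolutional code, i.e. a direct summand of $\mathbb{F}[z]^n$; equivalently, the matrix $G$ is right invertible over $\mathbb{F}[z]$. (e) The matrix $G$ is minimal. (f) $\mathcal{C}$ is a code with parameters $(n,k,km)$ and memory $m$. In particular, all Forney indices of $\mathcal{C}$ are equal to $m$.
   Context: Primitive idempotents: since $\mathrm{char}(\mathbb{F})\nmid n$, $x^n-1=\prod_{i=0}^{r-1}\pi_i$ with pairwise distinct monic irreducible $\pi_i\in\mathbb{F}[x]$; $\varepsilon^{(i)}\in A$ is the unique element with $\varepsilon^{(i)}\equiv\delta_{ij}\bmod \pi_j$ for all $j$. Every $\mathbb{F}$-algebra automorphism $\sigma$ of $A$ permutes $E=\{\varepsilon^{(0)},\dots,\varepsilon^{(r-1)}\}$. $\langle a\rangle$ is the ideal of $A$ generated by $a$; $\dim_{\mathbb{F}}\langle c\rangle=\sum_{\varepsilon^{(i)}\in S}\deg\pi_i$. Piret algebra: $A[z;\sigma]$ is the set of polynomials $\sum_{j=0}^N z^ja_j$ ($a_j\in A$, coefficients on the right of $z$) with usual addition and with multiplication determined by associativity, distributivity, the multiplication of $A$, and the rule $az=z\sigma(a)$ for $a\in A$. It contains $\mathbb{F}[z]$ and is a left $\mathbb{F}[z]$-module. The map $\mathfrak{p}:\mathbb{F}[z]^n\to A[z;\sigma]$, $\mathfrak{p}\big(\sum_\nu z^\nu v_\nu\big)=\sum_\nu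 z^\nu\mathfrak{p}(v_\nu)$, with $\mathfrak{p}(v_0,\dots,v_{n-1})=\sum_{i=0}^{n-1}v_ix^i\in A$ for $(v_0,\dots,v_{n-1})\in\mathbb{F}^n$, is an isomorphism of left $\mathbb{F}[z]$-modules; $\mathfrak{v}:=\mathfrak{p}^{-1}$. A submodule $\mathcal{C}\subseteq\mathbb{F}[z]^n$ is $\sigma$-cyclic if $\mathfrak{p}(\mathcal{C})$ is a left ideal of $A[z;\sigma]$. Convolutional codes: for a matrix $G\in\mathbb{F}[z]^{k\times n}$, $\mathrm{im}\,G=\{uG\mid u\in\mathbb{F}[z]^k\}$. A convolutional code with parameters $(n,k,\delta)$ is a submodule $\mathrm{im}\,G\subseteq\mathbb{F}[z]^n$ where $G\in\mathbb{F}[z]^{k\times n}$ is right invertible over $\mathbb{F}[z]$ and $\delta$ (the overall constraint length) is the maximal degree of the $k\times k$ minors of $G$. The degree of a row in $\mathbb{F}[z]^n$ is the maximum degree of its entries. A rank-$k$ matrix $G\in\mathbb{F}[z]^{k\times n}$ with row degrees $\nu_1,\dots,\nu_k$ and maximal degree of $k$-minors $\delta$ is minimal if $\delta=\sum_i\nu_i$; then the row degrees are uniquely determined (up to order) by $\mathrm{im}\,G$ and are called its Forney indices; the largest one is the memory. *)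

(* Defs.v *)
From HB Require Import structures.
From mathcomp Require Import all_boot all_order all_fingroup all_algebra.

Set Implicit Arguments.
Unset Strict Implicit.
Unset Printing Implicit Defensive.

Import GRing.Theory.
Local Open Scope ring_scope.

(* The skew polynomial ring A[z; sigma] with coefficients to the right of z:
   f`_nu is the coefficient a_nu in f = \sum_nu z^nu a_nu, and
   (z^i a) (z^j b) = z^(i + j) sigma^j(a) b. *)
Definition skew_poly (A : nzRingType) (sigma : {rmorphism A -> A}) : Type :=
  {poly A}.

Section SkewPoly.

Variables (A : nzRingType) (sigma : {rmorphism A -> A}).

HB.instance Definition _ := GRing.Zmodule.on (skew_poly sigma).

Implicit Types (a b : A) (f g h : skew_poly sigma).

Definition skew_coef f : nat -> A := nth 0 (f : {poly A}).

Definition skewC a : skew_poly sigma := a%:P.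

Definition skewX : skew_poly sigma := 'X.

Definition skew_mul f g : skew_poly sigma :=
  \poly_(l < (size (f : {poly A}) + size (g : {poly A})).-1)
    \sum_(j < l.+1) iter j sigma (skew_coef f (l - j)) * skew_coef g j.

Lemma skew_polyP f g : (forall l, skew_coef f l = skew_coef g l) <-> f = g.
Proof. by split=> [fg|-> //]; apply/polyP. Qed.

Lemma skew_coef0 l : skew_coef 0 l = 0.
Proof. by rewrite /skew_coef coef0. Qed.

Lemma skew_coefD f g l : skew_coef (f + g) l = skew_coef f l + skew_coef g l.
Proof. by rewrite /skew_coef coefD. Qed.

Lemma skew_coefC a l : skew_coef (skewC a) l = if l == 0%N then a else 0.
Proof. by rewrite /skew_coef coefC. Qed.

Lemma skew_coefX l : skew_coef skewX l = (l == 1%N)%:R.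
Proof. by rewrite /skew_coef coefX. Qed.

Lemma iter_sigma0 j : iter j sigma 0 = 0.
Proof. by elim: j => //= j ->; rewrite rmorph0. Qed.

Lemma iter_sigma1 j : iter j sigma 1 = 1.
Proof. by elim: j => //= j ->; rewrite rmorph1. Qed.

Lemma iter_sigmaD j : {morph iter j sigma : a b / a + b}.
Proof. by elim: j => // j IH a b; rewrite !iterS IH rmorphD. Qed.

Lemma iter_sigmaM j : {morph iter j sigma : a b / a * b}.
Proof. by elim: j => // j IH a b; rewrite !iterS IH rmorphM. Qed.

Lemma iter_sigma_sum j I (r : seq I) (P : pred I) (E : I -> A) :
  iter j sigma (\sum_(i <- r | P i) E i)
    = \sum_(i <- r | P i) iter j sigma (E i).
Proof. exact: (big_morph _ (iter_sigmaD j) (iter_sigma0 j)). Qed.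

Lemma skew_coef_mul f g l : skew_coef (skew_mul f g) l =
  \sum_(j < l.+1) iter j sigma (skew_coef f (l - j)) * skew_coef g j.
Proof.
rewrite {1}/skew_coef coef_poly; case: ltnP => // le_fg_l; rewrite big1 // => j _.
have [lt_j|le_j] := ltnP j (size (g : {poly A})); last first.
  by rewrite /(skew_coef g _) nth_default // mulr0.
rewrite /(skew_coef f _) nth_default ?iter_sigma0 ?mul0r //.
have le_jl : (j <= l)%N by rewrite -ltnS.
rewrite leq_subRL // (leq_trans _ le_fg_l) //.
by rewrite -ltnS prednK ?addn_gt0 ?(leq_ltn_trans _ lt_j) ?orbT // addnC ltn_add2l.
Qed.

Fact skew_mulA : associative skew_mul.
Proof.
move=> f g h; apply/skew_polyP => l; rewrite !skew_coef_mul.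
pose t j k := iter k sigma (skew_coef f (l - k))
                * (iter j sigma (skew_coef g (k - j)) * skew_coef h j).
transitivity (\sum_(k < l.+1) \sum_(j < l.+1 | (j <= k)%N) t j k).
  apply: eq_bigr => /= k _; rewrite skew_coef_mul big_distrr /=.
  by rewrite (big_ord_narrow_leq (ltn_ord k : k <= l)%N).
rewrite (exchange_big_dep predT) //=; apply: eq_bigr => j _.
rewrite skew_coef_mul iter_sigma_sum big_distrl /=.
rewrite -(big_mkord (fun k => j <= k)%N (fun k => t j k)).
rewrite (big_cat_nat (n := j)) ?(ltnW (ltn_ord j)) //=.
rewrite big_nat_cond big_pred0 ?Monoid.simpm => [|k]; last first.
  by case: ltnP => //; rewrite ?andbF // andbT.
rewrite -{1}[nat_of_ord j]add0n big_addn big_mkcond /= subSn -1?ltnS //.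
rewrite big_mkord; apply: eq_bigr => i _.
by rewrite leq_addl /t addnK iter_sigmaM -iterD addnC subnDA mulrA.
Qed.

Fact skew_mul1l : left_id (skewC 1) skew_mul.
Proof.
move=> f; apply/skew_polyP => l; rewrite skew_coef_mul big_ord_recr /=.
rewrite subnn skew_coefC iter_sigma1 mul1r big1 ?add0r // => j _.
by rewrite skew_coefC subn_eq0 leqNgt ltn_ord iter_sigma0 mul0r.
Qed.

Fact skew_mul1r : right_id (skewC 1) skew_mul.
Proof.
move=> f; apply/skew_polyP => l; rewrite skew_coef_mul big_ord_recl /=.
rewrite subn0 skew_coefC mulr1 big1 ?addr0 // => j _.
by rewrite skew_coefC mulr0.
Qed.

Fact skew_mulDl : left_distributive skew_mul +%R.
Proof.
move=> f g h; apply/skew_polyP => l.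
rewrite skew_coefD !skew_coef_mul -big_split /=; apply: eq_bigr => j _.
by rewrite skew_coefD iter_sigmaD mulrDl.
Qed.

Fact skew_mulDr : right_distributive skew_mul +%R.
Proof.
move=> f g h; apply/skew_polyP => l.
rewrite skew_coefD !skew_coef_mul -big_split /=; apply: eq_bigr => j _.
by rewrite skew_coefD mulrDr.
Qed.

Fact skew1_neq0 : skewC 1 != 0.
Proof. by rewrite polyC_eq0 oner_eq0. Qed.

HB.instance Definition _ := GRing.Zmodule_isNzRing.Build (skew_poly sigma)
  skew_mulA skew_mul1l skew_mul1r skew_mulDl skew_mulDr skew1_neq0.

Lemma skew_coefM f g l : skew_coef (f * g) l =
  \sum_(j < l.+1) iter j sigma (skew_coef f (l - j)) * skew_coef g j.
Proof. exact: skew_coef_mul. Qed.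

Fact skewC_is_zmod_morphism : zmod_morphism skewC.
Proof. by move=> a b; rewrite /skewC raddfB. Qed.

Fact skewC_is_monoid_morphism : monoid_morphism skewC.
Proof.
split=> // a b; apply/skew_polyP => l.
rewrite skew_coefM big_ord_recl /= subn0 !skew_coefC big1 ?addr0 => [|j _].
  by case: eqP => //; rewrite mul0r.
by rewrite (skew_coefC b) /= mulr0.
Qed.

HB.instance Definition _ :=
  GRing.isZmodMorphism.Build A (skew_poly sigma) skewC skewC_is_zmod_morphism.
HB.instance Definition _ :=
  GRing.isMonoidMorphism.Build A (skew_poly sigma) skewC
    skewC_is_monoid_morphism.

Lemma skew_coefMX f l :
  skew_coef (f * skewX) l = if l is l'.+1 then sigma (skew_coef f l') else 0.
Proof.
rewrite skew_coefM; case: l => [|l].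
  by rewrite big_ord1 skew_coefX /= mulr0.
rewrite !big_ord_recl big1 => [|j _] /=; rewrite !skew_coefX ?mulr0 //.
by rewrite subSS subn0 mulr1 addr0 add0r.
Qed.

Lemma skew_coefXM f l :
  skew_coef (skewX * f) l = if l is l'.+1 then skew_coef f l' else 0.
Proof.
rewrite skew_coefM; case: l => [|l].
  by rewrite big_ord1 skew_coefX mul0r.
rewrite !big_ord_recr big1 => [|j _] /=; rewrite !skew_coefX.
  by rewrite add0r subSnn subnn -!iterS iter_sigma1 iter_sigma0 mul1r mul0r addr0.
have lt_j : (j < l)%N by [].
by rewrite subSn 1?ltnW // eqSS subn_eq0 leqNgt lt_j iter_sigma0 mul0r.
Qed.

Lemma skewCX a : skewC a * skewX = skewX * skewC (sigma a).
Proof.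
apply/skew_polyP => -[|l]; rewrite skew_coefMX skew_coefXM // !skew_coefC.
by case: eqP => // _; rewrite rmorph0.
Qed.

Lemma skew_coefXnM i f l :
  skew_coef (skewX ^+ i * f) l = if (l < i)%N then 0 else skew_coef f (l - i).
Proof.
elim: i l => [|i IH] l; first by rewrite mul1r subn0.
by rewrite exprS -mulrA skew_coefXM; case: l => // l; rewrite IH.
Qed.

End SkewPoly.

Section Modules.

Variable R : nzRingType.

Definition left_ideal (I : R -> Prop) : Prop :=
  [/\ I 0, forall x y, I x -> I y -> I (x + y)
    & forall a x, I x -> I (a * x)].

Definition submodule (V : lmodType R) (C : V -> Prop) : Prop :=
  [/\ C 0, forall v w, C v -> C w -> C (v + w)
    & forall a v, C v -> C (a *: v)].

Definition direct_summand (V : lmodType R) (C : V -> Prop) : Prop :=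
  submodule C /\
  exists D : V -> Prop,
    [/\ submodule D,
        forall w, exists u v, [/\ C u, D v & w = u + v]
      & forall w, C w -> D w -> w = 0].

Definition two_sided_unit (x : R) : Prop :=
  exists y : R, x * y = 1 /\ y * x = 1.

End Modules.

Section Matrices.

Variable F : fieldType.
Implicit Types (k n : nat).

Definition mx_im k n (G : 'M[{poly F}]_(k, n)) (w : 'rV[{poly F}]_n) : Prop :=
  exists u : 'rV[{poly F}]_k, w = u *m G.

Definition right_invertible k n (G : 'M[{poly F}]_(k, n)) : Prop :=
  exists H : 'M[{poly F}]_(n, k), G *m H = 1%:M.

(* The free submodule C has a basis (the rows of B) of cardinality k. *)
Definition free_rank n (C : 'rV[{poly F}]_n -> Prop) (k : nat) : Prop :=
  exists B : 'M[{poly F}]_(k, n),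
    injective (fun u : 'rV[{poly F}]_k => u *m B)
    /\ forall w, C w <-> mx_im B w.

(* The k-minors are indexed by the strictly increasing choices of columns;
   degrees are (size p).-1, so the zero polynomial counts as degree 0. *)
Definition max_minor_degree k n (G : 'M[{poly F}]_(k, n)) : nat :=
  \max_(f : {ffun 'I_k -> 'I_n}
          | [forall i : 'I_k, forall j : 'I_k, (i < j)%N ==> (f i < f j)%N])
    (size (\det (colsub f G))).-1.

Definition row_degree k n (G : 'M[{poly F}]_(k, n)) (i : 'I_k) : nat :=
  \max_(j < n) (size (G i j)).-1.

(* The rank is taken over the field of fractions F(z). *)
Definition minimal_mx k n (G : 'M[{poly F}]_(k, n)) : Prop :=
  \rank (map_mx (@tofrac {poly F}) G) = k
  /\ max_minor_degree G = (\sum_(i < k) row_degree G i)%N.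

Definition conv_code n (k delta : nat) (C : 'rV[{poly F}]_n -> Prop) : Prop :=
  exists G : 'M[{poly F}]_(k, n),
    [/\ right_invertible G, forall w, C w <-> mx_im G w
      & max_minor_degree G = delta].

(* s lists, in some order, the row degrees of a minimal matrix generating C. *)
Definition forney_indices n (C : 'rV[{poly F}]_n -> Prop) (s : seq nat) : Prop :=
  exists k (G : 'M[{poly F}]_(k, n)),
    [/\ minimal_mx G, forall w, C w <-> mx_im G w
      & perm_eq s [seq row_degree G i | i <- enum 'I_k]].

Definition has_memory n (C : 'rV[{poly F}]_n -> Prop) (mu : nat) : Prop :=
  exists2 s, forney_indices C s & mu = (\max_(d <- s) d)%N.

End Matrices.

(* A = F[x] / <x^n - 1>, meaningful for n >= 1: the library's {poly %/ p} is the
   quotient by p when p is monic and nonconstant.  Its elements are represented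
   by polynomials of degree < n, and x is 'qX. *)
Notation cyc_alg F n := {poly %/ ('X^n - 1 : {poly F})}.

Section CyclicAlgebra.

Variables (F : finFieldType) (n : nat).

Local Notation A := (cyc_alg F n).

(* eps i is congruent to the Kronecker delta of i and j modulo ppi j. *)
Definition primitive_idempotents (r : nat)
    (ppi : 'I_r -> {poly F}) (eps : 'I_r -> A) : Prop :=
  [/\ forall i, ppi i \is monic,
      forall i, irreducible_poly (ppi i),
      injective ppi,
      'X^n - 1 = \prod_(i < r) ppi i
    & forall i j, ppi j %| ((eps i : {poly F}) - (i == j)%:R)].

(* The ideal generated by c is the image of the linear map a |-> a * c. *)
Definition principal_ideal_dim (c : A) : nat :=
  \dim (limg (linfun (fun a : A => a * c))).

Definition pmap0 (v : 'rV[F]_n) : A := \sum_(i < n) v 0 i *: 'qX ^+ i.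

Definition vmap0 (a : A) : 'rV[F]_n := \row_(i < n) (a : {poly F})`_i.

Variable sigma : {lrmorphism A -> A}.

Definition coef_rV (v : 'rV[{poly F}]_n) (nu : nat) : 'rV[F]_n :=
  \row_(i < n) (v 0 i)`_nu.

Definition pmap (v : 'rV[{poly F}]_n) : skew_poly sigma :=
  \sum_(nu < \max_(i < n) size (v 0%R i))
    skewX sigma ^+ nu * skewC sigma (pmap0 (coef_rV v nu)).

(* The inverse of pmap: see pmapK and vmapK below. *)
Definition vmap (f : skew_poly sigma) : 'rV[{poly F}]_n :=
  \row_(i < n) \poly_(nu < size (f : {poly A})) vmap0 (skew_coef f nu) 0 i.

Definition sigma_cyclic (C : 'rV[{poly F}]_n -> Prop) : Prop :=
  submodule C
  /\ left_ideal (fun f : skew_poly sigma => exists2 v, C v & f = pmap v).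

Lemma size_modulus :
  (0 < n)%N -> size (mk_monic ('X^n - 1 : {poly F})) = n.+1.
Proof.
move=> n_gt0; rewrite /mk_monic (monicXnsubC 1) // size_XnsubC //.
by rewrite ltnS n_gt0 size_XnsubC.
Qed.

Lemma qX_exp (i : nat) : (i < n)%N -> (('qX : A) ^+ i : {poly F}) = 'X^i.
Proof.
move=> lt_in.
have -> : ('qX : A) ^+ i = in_qpoly ('X^n - 1) 'X^i by rewrite rmorphXn.
rewrite in_qpoly_small //.
by rewrite size_polyXn size_modulus ?(leq_ltn_trans _ lt_in).
Qed.

Lemma coef_pmap0 v (i : 'I_n) : (pmap0 v : {poly F})`_i = v 0 i.
Proof.
rewrite /pmap0 raddf_sum /= coef_sum (bigD1 i) //= big1 => [|j neq_ji].
  by rewrite coefZ qX_exp // coefXn eqxx mulr1 addr0.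
have ji : (i == j :> nat) = false by rewrite eq_sym; apply: negbTE.
by rewrite coefZ qX_exp // coefXn ji mulr0.
Qed.

Lemma pmap0K : cancel pmap0 vmap0.
Proof. by move=> v; apply/rowP => i; rewrite mxE coef_pmap0. Qed.

Lemma vmap0K : (0 < n)%N -> cancel vmap0 pmap0.
Proof.
move=> n_gt0 a; apply: val_inj; apply/polyP => i /=.
have [lt_in|le_ni] := ltnP i n; last first.
  have sz (b : A) : (size (b : {poly F}) <= i)%N.
    by rewrite (leq_trans _ le_ni) // -ltnS -size_modulus // size_mk_monic.
  by rewrite !nth_default ?sz.
by rewrite (coef_pmap0 _ (Ordinal lt_in)) mxE.
Qed.

Lemma pmap0_0 : pmap0 0 = 0.
Proof. by rewrite /pmap0 big1 // => i _; rewrite mxE scale0r. Qed.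

Lemma vmap0_0 : vmap0 0 = 0.
Proof. by apply/rowP => i; rewrite !mxE coef0. Qed.

Lemma skew_coef_pmap v nu : skew_coef (pmap v) nu = pmap0 (coef_rV v nu).
Proof.
rewrite /pmap; set N := (\max_(i < n) _)%N.
have -> (E : 'I_N -> skew_poly sigma) :
    skew_coef (\sum_i E i) nu = \sum_i skew_coef (E i) nu.
  apply: (big_morph (fun f : skew_poly sigma => skew_coef f nu)).
    by move=> f g; apply: skew_coefD.
  exact: skew_coef0.
have [lt_nu|le_nu] := ltnP nu N.
  rewrite (bigD1 (Ordinal lt_nu)) //= big1 => [|mu neq_mu].
    by rewrite skew_coefXnM ltnn subnn skew_coefC addr0.
  rewrite skew_coefXnM skew_coefC; case: ltnP => // le_mu.
  by rewrite subn_eq0 leqNgt ltn_neqAle le_mu andbT -val_eqE /= in neq_mu *; rewrite neq_mu.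
rewrite big1 => [|mu _].
  rewrite (_ : coef_rV v nu = 0) ?pmap0_0 //; apply/rowP => i; rewrite !mxE.
  rewrite nth_default // (leq_trans _ le_nu) //.
  exact: (leq_bigmax (F := fun i => size (v 0 i))).
have lt_mu : (mu < nu)%N := leq_trans (ltn_ord mu) le_nu.
by rewrite skew_coefXnM skew_coefC ltnNge (ltnW lt_mu) /= subn_eq0 leqNgt lt_mu.
Qed.

Lemma coef_vmap f i nu : (vmap f 0 i)`_nu = vmap0 (skew_coef f nu) 0 i.
Proof.
rewrite mxE coef_poly; case: ltnP => // le_f_nu.
by rewrite /skew_coef nth_default // vmap0_0 mxE.
Qed.

Lemma pmapK : cancel pmap vmap.
Proof.
move=> v; apply/rowP => i; apply/polyP => nu.
by rewrite coef_vmap skew_coef_pmap pmap0K mxE.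
Qed.

Lemma vmapK : (0 < n)%N -> cancel vmap pmap.
Proof.
move=> n_gt0 f; apply/skew_polyP => nu.
rewrite skew_coef_pmap -[RHS](vmap0K n_gt0); congr pmap0.
by apply/rowP => i; rewrite mxE coef_vmap.
Qed.

End CyclicAlgebra.

(* Main.v *)
(* The automorphism permutes the primitive idempotents, so the disjointness
   hypothesis makes c, sigma(c), ..., sigma^m(c) pairwise orthogonal; this gives
   the factorizations of g and u by direct expansion.  Orthogonality also
   yields, for each mu <= m, a constant matrix H_mu (coordinates of
   a * sigma^mu(c) in the basis sigma^mu(x^i c)) with G_nu H_mu = 0 for nu <> mu
   and G_mu H_mu = 1, i.e. G H_mu = z^mu.  Then H_0 is a right inverse of G,
   while G H_m = z^m shows that no cancellation occurs in top degree: t G has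
   degree at least m for every nonzero row vector t, which gives minimality and
   the uniqueness of the Forney indices. *)
Require Import Defs.
From HB Require Import structures.
From mathcomp Require Import all_boot all_order all_fingroup all_algebra.

Set Implicit Arguments.
Unset Strict Implicit.
Unset Printing Implicit Defensive.

Import GRing.Theory.
Local Open Scope ring_scope.

(** * Primitive idempotents of a commutative ring *)

Section PrimitiveIdempotents.

Variable A : comNzRingType.

Lemma mulr1B_eq0 (e f : A) : e * (1 - f) = 0 -> e * f = e.
Proof. by move/eqP; rewrite mulrBr mulr1 subr_eq0 => /eqP <-. Qed.

(** Phrased by ring operations alone, so that automorphisms transport it. Zero satisfies it;
    nonvanishing is treated apart, in [eps_neq0]. *)
Definition primitive_idempotent (e : A) : Prop :=
  e * e = e /\ forall f, f * f = f -> e * f = f -> f = 0 \/ f = e.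

(** The product is an idempotent below both [e] and [e'], so if it were nonzero it would equal
    both. *)
Lemma primitive_orthogonal (e e' : A) :
  primitive_idempotent e -> primitive_idempotent e' -> e <> e' -> e * e' = 0.
Proof.
move=> [ee e_min] [ee' e'_min] neq_ee'.
have ff : (e * e') * (e * e') = e * e' by rewrite mulrACA ee ee'.
have [//|f_e] := e_min _ ff (etrans (mulrA _ _ _) (congr1 (fun x => x * e') ee)).
have [//|f_e'] : e * e' = 0 \/ e * e' = e'.
  by apply: e'_min => //; rewrite mulrCA ee'.
by case: neq_ee'; rewrite -f_e -{2}f_e'.
Qed.

Lemma primitive_morph (tau : {rmorphism A -> A}) (e : A) :
  bijective tau -> primitive_idempotent e -> primitive_idempotent (tau e).
Proof.
move=> [tau' tauK tau'K] [ee e_min]; split=> [|f ff ef]; first by rewrite -rmorphM ee.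
have inj := can_inj tauK.
(* [tau'] is a bare inverse function, so equations between its values are checked after applying
   [tau]. *)
have tau'_ff : tau' f * tau' f = tau' f by apply: inj; rewrite rmorphM /= tau'K.
have tau'_ef : e * tau' f = tau' f by apply: inj; rewrite rmorphM /= tau'K.
rewrite -(tau'K f); have [->|->] := e_min _ tau'_ff tau'_ef; last by right.
by left; rewrite rmorph0.
Qed.

End PrimitiveIdempotents.

(** * The idempotents of the Chinese remainder decomposition *)

Section CyclicIdempotents.

Variables (F : finFieldType) (n : nat).
Hypothesis n_gt0 : (0 < n)%N.

Local Notation A := (cyc_alg F n).

Variables (r : nat) (ppi : 'I_r -> {poly F}) (eps : 'I_r -> A).
Hypothesis eps_prim : primitive_idempotents ppi eps.

Let ppi_irr i : irreducible_poly (ppi i).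
Proof. by case: eps_prim. Qed.

Lemma mk_monic_Xn_sub1 : mk_monic ('X^n - 1 : {poly F}) = 'X^n - 1.
Proof. by rewrite /mk_monic (monicXnsubC 1) // size_XnsubC // ltnS n_gt0. Qed.

Lemma coprimep_factors i j : i != j -> coprimep (ppi i) (ppi j).
Proof.
case: eps_prim => mon irr inj _ _ neq_ij.
rewrite irreducible_poly_coprime //; apply: contraNN neq_ij => dvd_ij.
have /(_ (ppi i)) := (irr j).2; rewrite dvd_ij neq_ltn (irr i).1 orbT.
by move=> /(_ isT isT); rewrite eqp_monic // => /eqP /inj ->.
Qed.

(** The factors are pairwise coprime, so their product ['X^n - 1] divides the representative of [a],
    whose degree is too small unless it is zero. *)
Lemma cyc_alg_eq0 (a : A) : (forall j, ppi j %| (a : {poly F})) -> a = 0.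
Proof.
move=> dvd_a; apply: val_inj => /=.
have dvd_all (s : seq 'I_r) : uniq s -> \prod_(i <- s) ppi i %| (a : {poly F}).
  elim: s => [|i s IH] /=; first by rewrite big_nil dvd1p.
  case/andP=> i_s s_uniq; rewrite big_cons Gauss_dvdp ?dvd_a ?IH //.
  rewrite big_seq; elim/big_rec: _ => [|j p j_s cop]; first exact: coprimep1.
  by rewrite coprimepMr cop coprimep_factors //; apply: contraNneq i_s => ->.
have := dvd_all _ (index_enum_uniq _); case: eps_prim => _ _ _ <- _ dvd_a_mod.
apply/eqP; apply: contraTT dvd_a_mod => a_neq0.
by rewrite gtNdvdp // (leq_trans (size_mk_monic a)) // mk_monic_Xn_sub1.
Qed.

(** Products in [A] may be reduced modulo [ppi j] because it divides ['X^n - 1]; and an irreducible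
    polynomial is prime. *)
Lemma cyc_alg_mulE (j : 'I_r) (a b : A) :
  ppi j %| (a * b : A) = (ppi j %| (a : {poly F})) || (ppi j %| (b : {poly F})).
Proof.
have -> : (a * b : {poly F}) = ((a : {poly F}) * b) %% ('X^n - 1).
  rewrite poly_of_qpolyM -Pdiv.IdomainMonic.modpE ?monic_mk_monic //.
  by congr (_ %% _); exact: mk_monic_Xn_sub1.
have dvd_mod : ppi j %| 'X^n - 1.
  have -> : 'X^n - 1 = \prod_i ppi i by case: eps_prim.
  by rewrite (bigD1 j) //= dvdp_mulr.
rewrite -(dvdp_mod _ dvd_mod); apply/idP/idP => [dvd_ab|]; last first.
  by case/orP=> dvd; rewrite ?(dvdp_mulr _ dvd) ?(dvdp_mull _ dvd).
have [//|ndvd_a] := boolP (ppi j %| (a : {poly F})).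
have cop : coprimep (ppi j) (a : {poly F}) by rewrite irreducible_poly_coprime.
by rewrite (Gauss_dvdpr _ cop) in dvd_ab.
Qed.

Lemma eps_dvd i j : i != j -> ppi j %| (eps i : {poly F}).
Proof.
by move=> /negPf neq_ij; case: eps_prim => _ _ _ _ /(_ i j); rewrite neq_ij subr0.
Qed.

Lemma eps_dvd1 i : ppi i %| ((1 - eps i : A) : {poly F}).
Proof.
case: eps_prim => _ _ _ _ /(_ i i); by rewrite eqxx -dvdpNr opprB.
Qed.

Lemma eps_neq0 i : eps i <> 0.
Proof.
move=> eps0; have := eps_dvd1 i; rewrite eps0 subr0 /= dvdp1 => /eqP sz1.
by have := (ppi_irr i).1; rewrite sz1.
Qed.

(** An idempotent is 0 or 1 modulo each factor. Below [eps i] it vanishes modulo every factor but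
    [ppi i], so its residue there decides between 0 and [eps i]. *)
Lemma eps_primitive i : primitive_idempotent (eps i).
Proof.
split=> [|f ff ef].
  apply: mulr1B_eq0.
  apply: cyc_alg_eq0 => j; rewrite cyc_alg_mulE.
  by have [<-|neq] := eqVneq i j; [rewrite eps_dvd1 orbT | rewrite eps_dvd].
have : ppi i %| (f * (1 - f) : A) by rewrite mulrBr mulr1 ff subrr dvdp0.
rewrite cyc_alg_mulE => /orP[dvd_f|dvd_1f]; [left|right].
  apply: cyc_alg_eq0 => j; have [<-//|neq] := eqVneq i j.
  by rewrite -ef cyc_alg_mulE eps_dvd.
rewrite -ef; apply: mulr1B_eq0.
apply: cyc_alg_eq0 => j; rewrite cyc_alg_mulE.
by have [<-|neq] := eqVneq i j; [rewrite dvd_1f orbT | rewrite eps_dvd].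
Qed.

End CyclicIdempotents.

(** * Factorizations in the skew polynomial ring *)

Section SkewIdentities.

Variables (A : comNzRingType) (sigma : {rmorphism A -> A}).

Local Notation z := (skewX sigma).
Local Notation C_ := (skewC sigma).
Local Notation "a ^[ j ]" := (iter j sigma a) (at level 2, format "a ^[ j ]").

Lemma skewCXn (a : A) j : C_ a * z ^+ j = z ^+ j * C_ a^[j].
Proof.
elim: j => [|j IH]; first by rewrite !expr0 mulr1 mul1r.
by rewrite exprSr mulrA IH -mulrA skewCX mulrA.
Qed.

Lemma skew_mulXC (a b : A) : (z * C_ a) * (z * C_ b) = z ^+ 2 * C_ (sigma a * b).
Proof. by rewrite -mulrA (mulrA (C_ a)) skewCX rmorphM /= expr2 !mulrA. Qed.

Variables (c : A) (m : nat).
Hypothesis c_idem : c * c = c.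
Hypothesis c_orth : forall j, (1 <= j <= m)%N -> c * c^[j] = 0.

Lemma iter_idem j : c^[j] * c^[j] = c^[j].
Proof. by rewrite -iter_sigmaM c_idem. Qed.

Lemma iter_orth i j : (i < j <= i + m)%N -> c^[i] * c^[j] = 0.
Proof.
case/andP=> lt_ij le_j; rewrite -(subnKC (ltnW lt_ij)) iterD -iter_sigmaM.
by rewrite c_orth ?iter_sigma0 // subn_gt0 lt_ij leq_subLR.
Qed.

Lemma skew_geomE :
  C_ c * \sum_(nu < m.+1) z ^+ nu = \sum_(nu < m.+1) z ^+ nu * C_ c^[nu].
Proof. by rewrite mulr_sumr; apply: eq_bigr => nu _; rewrite skewCXn. Qed.

(** Multiplying the term of index [nu] by [z * C_ c^[l.+1]] gives the coefficient [c^[nu.+1] *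
    c^[l.+1]], so only the top term [nu = l] survives and supplies the next summand. *)
Lemma skew_geom_prod l : (l <= m)%N ->
  \sum_(nu < l.+1) z ^+ nu * C_ c^[nu]
    = C_ c * \prod_(1 <= j < l.+1) (1 + z * C_ c^[j]).
Proof.
elim: l => [|l IH] le_lm.
  by rewrite big_ord1 big_nil expr0 mul1r mulr1.
rewrite big_nat_recr //= mulrA -IH ?(ltnW le_lm) // mulrDr mulr1 big_ord_recr /=.
congr (_ + _); rewrite mulr_suml.
have step (nu : nat) : z ^+ nu * C_ c^[nu] * (z * C_ c^[l.+1])
    = z ^+ nu.+1 * C_ (c^[nu.+1] * c^[l.+1]).
  by rewrite -mulrA (mulrA (C_ _)) skewCX rmorphM /= exprSr !mulrA.
rewrite big_ord_recr /= big1 ?add0r => [|nu _]; rewrite step.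
  by rewrite iter_idem.
by rewrite iter_orth ?rmorph0 ?mulr0 // ltnS ltn_ord (leq_trans le_lm) ?leq_addl.
Qed.

(** [z * C_ c^[j]] squares to zero, since its square has coefficient [c^[j.+1] * c^[j]];
    orthogonality at distance 1 is available because [m] is positive. *)
Lemma skew_factor_inv j : (0 < m)%N ->
  (1 + z * C_ c^[j]) * (1 - z * C_ c^[j]) = 1
  /\ (1 - z * C_ c^[j]) * (1 + z * C_ c^[j]) = 1.
Proof.
move=> m_gt0; have sq0 : (z * C_ c^[j]) * (z * C_ c^[j]) = 0.
  rewrite skew_mulXC -iterS mulrC iter_orth ?rmorph0 ?mulr0 //.
  by rewrite ltnSn -addn1 leq_add2l.
split; rewrite mulrDl mul1r mulrDr mulr1 ?mulrN ?mulNr sq0 ?oppr0.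
  by rewrite addr0 subrK.
by rewrite addr0 addrK.
Qed.

Lemma skew_prod_inv l (v := \prod_(1 <= j < l.+1) (1 + z * C_ c^[j]))
    (u := \prod_(0 <= j < l) (1 - z * C_ c^[l - j])) :
  (l <= m)%N -> v * u = 1 /\ u * v = 1.
Proof.
rewrite {}/v {}/u; elim: l => [|l IH] le_lm; first by rewrite !big_nil mulr1.
have [vu uv] := IH (ltnW le_lm).
have [inv1 inv2] := skew_factor_inv l.+1 (leq_trans (ltn0Sn l) le_lm).
rewrite big_nat_recr //=.
(* The index [l - j] descends from [l] to 1, so the new factor enters on the left, facing its
   inverse at the right end of the other product. *)
have -> : \prod_(0 <= j < l.+1) (1 - z * C_ c^[l.+1 - j])
    = (1 - z * C_ c^[l.+1]) * \prod_(0 <= j < l) (1 - z * C_ c^[l - j]).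
  by rewrite big_nat_recl.
split; first by rewrite mulrA -(mulrA _ (1 + _)) inv1 mulr1.
by rewrite mulrA -(mulrA (1 - _)) uv mulr1.
Qed.

Lemma skew_prod_sum l : (l <= m)%N ->
  \prod_(0 <= j < l) (1 - z * C_ c^[l - j])
    = 1 - z * C_ (\sum_(1 <= j < l.+1) c^[j]).
Proof.
elim: l => [|l IH] le_lm; first by rewrite !big_nil rmorph0 mulr0 subr0.
rewrite big_nat_recl //= IH ?(ltnW le_lm) //; set s := \sum_(_ <= j < _) _.
rewrite [in RHS]big_nat_recr //= -/s mulrDl mul1r mulrDr mulr1 mulrNN skew_mulXC.
rewrite [_ * s]big_distrr big_nat big1 /= ?rmorph0 ?mulr0 => [|j /andP[j_gt0 j_le]].
  by rewrite addr0 rmorphD mulrDr opprD addrA.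
(* The cross term pairs the exponents [j] and [l.+2]; as [j] is at least 1, their distance is at
   most [l.+1], hence at most [m]. *)
rewrite -!iterS mulrC iter_orth // (leqW j_le) /=.
by rewrite (leq_trans _ (leq_add j_gt0 le_lm)).
Qed.

End SkewIdentities.

(** * Leading coefficients of minors *)

Section MatrixMinors.

(** With [m] as a bound for all degrees, the exponent [size s * m] is reached only by taking the
    coefficient of index [m] in every factor. *)
Lemma coef_prod_top (R : comNzRingType) (I : Type) (s : seq I) (p : I -> {poly R})
    (m : nat) : (forall i, (size (p i) <= m.+1)%N) ->
  (size (\prod_(i <- s) p i)%R <= (size s * m).+1)%N
  /\ (\prod_(i <- s) p i)`_(size s * m) = \prod_(i <- s) (p i)`_m.
Proof.
move=> sz_p; elim: s => [|i s [sz_s coef_s]].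
  by rewrite !big_nil mul0n coef1 size_poly1.
rewrite !big_cons /= mulSn; split.
  rewrite (leq_trans (size_polyMleq _ _)) // -subn1 leq_subLR add1n.
  by rewrite (leq_trans (leq_add (sz_p i) sz_s)) // addSn addnS.
rewrite coefM (bigD1 (Ordinal (leq_addr (size s * m) m : m < _.+1)%N)) //=.
rewrite addKn coef_s [X in _ + X]big1 ?addr0 // => j; rewrite -val_eqE /= => neq_jm.
(* An index below [m] demands a coefficient of the remaining product beyond its bound; an index
   above [m] exceeds the bound of [p i]. *)
have [lt_jm|lt_mj|eq_jm] := ltngtP j m; last by rewrite eq_jm eqxx in neq_jm.
  rewrite [X in _ * X]nth_default ?mulr0 // (leq_trans sz_s) //.
  by rewrite -addnBAC ?(ltnW lt_jm) // -add1n leq_add2r subn_gt0.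
by rewrite nth_default ?mul0r // (leq_trans (sz_p i)).
Qed.

(** Apply [coef_prod_top] to each term of the Leibniz expansion. *)
Lemma coef_det_top (R : comNzRingType) (k m : nat) (M : 'M[{poly R}]_k) :
  (forall i j, (size (M i j) <= m.+1)%N) ->
  (size (\det M)%R <= (k * m).+1)%N /\ (\det M)`_(k * m) = \det (map_mx (coefp m) M).
Proof.
move=> sz_M; have top (s : 'S_k) := coef_prod_top (index_enum 'I_k)
  (fun i => sz_M i (s i)).
have card_k : size (index_enum 'I_k) = k.
  by rewrite -[RHS]card_ord cardT enumT.
rewrite card_k in top; split.
  rewrite (leq_trans (size_sum _ _ _)) //; apply/bigmax_leqP => s _.
  by rewrite mulr_sign; case: odd_perm; rewrite ?size_polyN (top s).1.
rewrite coef_sum; apply: eq_bigr => s _.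
rewrite !mulr_sign; under [in RHS]eq_bigr do rewrite mxE /=.
by case: odd_perm; rewrite ?coefN (top s).2.
Qed.

Lemma ltn_enum_val (n : nat) (X : {set 'I_n}) (i j : 'I_#|X|) :
  (i < j)%N -> (enum_val i < enum_val j)%N.
Proof.
move=> lt_ij; have srt : sorted ltn [seq val x | x <- enum X].
  rewrite sorted_map /enum_mem -enumT.
  apply: (sorted_filter (leT := relpre val ltn)); first by move=> x y z /=; apply: ltn_trans.
  by rewrite -sorted_map val_enum_ord iota_ltn_sorted.
have x0 : 'I_n := enum_val i.
rewrite !(enum_val_nth x0) -!(nth_map x0 0%N) -?cardE //.
by rewrite (sorted_ltn_nth ltn_trans) ?inE ?size_map -?cardE.
Qed.

Definition increasing (k n : nat) (f : {ffun 'I_k -> 'I_n}) : bool :=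
  [forall i : 'I_k, forall j : 'I_k, (i < j)%N ==> (f i < f j)%N].

(** [fullrankfun] selects [k] independent columns in no prescribed order; enumerating its image puts
    them in increasing order. *)
Lemma row_free_minor (F : fieldType) (k n : nat) (M : 'M[F]_(k, n)) :
  row_free M -> exists2 f : {ffun 'I_k -> 'I_n}, increasing f & \det (colsub f M) != 0.
Proof.
move=> M_free; have Mt_full : row_full M^T by rewrite /row_full mxrank_tr.
pose X := [set fullrankfun Mt_full i | i : 'I_k].
have cardX : #|X| = k by rewrite card_imset ?card_ord //; exact: fullrankfun_inj.
pose f := [ffun i => enum_val (cast_ord (esym cardX) i)].
exists f.
  by apply/forallP => i; apply/forallP => j; apply/implyP => lt_ij; rewrite !ffunE ltn_enum_val.
rewrite -unitfE -unitmxE -unitmx_tr trmx_mxsub -row_full_unit -sub1mx.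
(* Each column chosen by [fullrankfun] occurs among those chosen by [f], so the span is still
   everything. *)
rewrite (submx_trans (_ : (1%:M <= rowsub (fullrankfun Mt_full) M^T)%MS)) //.
  by rewrite sub1mx fullrowsub_full.
apply/row_subP => i; rewrite row_rowsub.
have Xi : fullrankfun Mt_full i \in X by apply/imsetP; exists i.
pose j := cast_ord cardX (enum_rank_in Xi (fullrankfun Mt_full i)).
by rewrite (eq_row_sub j) // row_rowsub ffunE cast_ordK enum_rankK_in.
Qed.

End MatrixMinors.

(** * Images of polynomial matrices *)

Section MatrixImage.

Variables (F : fieldType) (n : nat).

Lemma mx_im_submodule k (G : 'M[{poly F}]_(k, n)) : submodule (mx_im G).
Proof.
split=> [|_ _ [u ->] [v ->]|a _ [u ->]]; first by exists 0; rewrite mul0mx.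
  by exists (u + v); rewrite mulmxDl.
by exists (a *: u); rewrite scalemxAl.
Qed.

Lemma right_invertible_summand k (G : 'M[{poly F}]_(k, n)) :
  right_invertible G -> direct_summand (mx_im G).
Proof.
move=> [H GH]; split; first exact: mx_im_submodule.
(* Since [G *m H] is the identity, [w |-> w *m H *m G] projects onto the image, with this kernel as
   complement. *)
exists (fun w => w *m H = 0); split.
- split=> [|v w vH wH|a v vH]; first by rewrite mul0mx.
    by rewrite mulmxDl vH wH addr0.
  by rewrite -scalemxAl vH scaler0.
- move=> w; exists (w *m H *m G), (w - w *m H *m G); split.
  + by exists (w *m H).
  + by rewrite mulmxBl -(mulmxA _ G) GH mulmx1 subrr.
  + by rewrite addrC subrK.
- by move=> _ [u ->]; rewrite -mulmxA GH mulmx1 => ->; rewrite mul0mx.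
Qed.

Lemma right_invertible_inj k (G : 'M[{poly F}]_(k, n)) :
  right_invertible G -> injective (fun u : 'rV[{poly F}]_k => u *m G).
Proof.
move=> [H GH]; apply: (can_inj (g := mulmx^~ H)) => u.
by rewrite -mulmxA GH mulmx1.
Qed.

Lemma right_invertible_rank k (G : 'M[{poly F}]_(k, n)) :
  right_invertible G -> \rank (map_mx (@tofrac {poly F}) G) = k.
Proof.
move=> [H GH]; apply/eqP/row_freeP; exists (map_mx (@tofrac {poly F}) H).
by rewrite -map_mxM GH map_mx1.
Qed.

Lemma mx_im_sub k l (G : 'M[{poly F}]_(k, n)) (G' : 'M[{poly F}]_(l, n)) :
  (forall w, mx_im G' w -> mx_im G w) -> exists T, G' = T *m G.
Proof.
move=> sub; have /fin_all_exists[T TE] i : exists u, row i G' = u *m G.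
  by apply: sub; exists (delta_mx 0 i); rewrite rowE.
exists (\matrix_i T i); apply/row_matrixP => i.
by rewrite row_mul rowK.
Qed.

Lemma mx_im_rank_le k l (G : 'M[{poly F}]_(k, n)) (G' : 'M[{poly F}]_(l, n)) :
    (forall w, mx_im G' w -> mx_im G w) ->
  (\rank (map_mx (@tofrac {poly F}) G') <= \rank (map_mx (@tofrac {poly F}) G))%N.
Proof. by move/mx_im_sub=> [T ->]; rewrite map_mxM mxrankM_maxr. Qed.

End MatrixImage.

Lemma map_eq_const (T U : Type) (f : T -> U) (y : U) (s : seq T) :
  (forall x, f x = y) -> map f s = nseq (size s) y.
Proof. by move=> fy; elim: s => //= x s ->; rewrite fy. Qed.

(** * Minimality and Forney indices from a constant inverse up to a power of the variable *)

Section ConstantLeadingInverse.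

Variables (F : fieldType) (k n m : nat) (G : 'M[{poly F}]_(k, n)).
Hypothesis sz_G : forall i j, (size (G i j) <= m.+1)%N.
Variable H : 'M[F]_(n, k).
Hypothesis GH : G *m map_mx polyC H = 'X^m%:M.

(** Comparing coefficients of index [m] in [GH] shows that [H] is a right inverse of the leading
    coefficient matrix. *)
Lemma lead_mx_free : row_free (map_mx (coefp m) G).
Proof.
apply/row_freeP; exists H; apply/matrixP => i j.
have /matrixP/(_ i j)/(congr1 (fun p : {poly F} => p`_m)) := GH.
rewrite !mxE coefMn coefXn eqxx coef_sum => <-.
by apply: eq_bigr => l _; rewrite !mxE coefMC.
Qed.

(** Every minor has degree at most [k * m], with the corresponding minor of the leading matrix as
    its coefficient there; one of these is nonzero. *)
Lemma max_minor_degreeE : max_minor_degree G = (k * m)%N.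
Proof.
have top (f : {ffun 'I_k -> 'I_n}) : (size (\det (colsub f G)) <= (k * m).+1)%N
    /\ (\det (colsub f G))`_(k * m) = \det (colsub f (map_mx (coefp m) G)).
  by rewrite -map_mxsub; apply: coef_det_top => i j; rewrite mxE.
apply/eqP; rewrite eqn_leq; apply/andP; split.
  by apply/bigmax_leqP => f _; rewrite -subn1 leq_subLR add1n (top f).1.
have [f f_incr det_f] := row_free_minor lead_mx_free.
rewrite (bigmax_sup f) // -ltnS (leq_trans _ (leqSpred _)) // ltnNge.
by apply: contraNN det_f => /leq_sizeP le_sz; rewrite -(top f).2 le_sz.
Qed.

(* The top coefficients cannot cancel: T G H = z^m T, and H is constant. *)
Lemma row_degree_mul_ge l (T : 'M[{poly F}]_(l, k)) i :
  row i T != 0 -> (m <= row_degree (T *m G) i)%N.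
Proof.
case/rV0Pn=> j; rewrite mxE => T_ij; rewrite leqNgt; apply/negP => lt_m.
have sz_TG j' : (size ((T *m G) i j') <= m)%N.
  rewrite (leq_trans (leqSpred _)) // (leq_trans _ lt_m) // ltnS.
  exact: (leq_bigmax (F := fun j' => (size ((T *m G) i j')).-1)).
have : ('X^m * T i j : {poly F}) = \sum_l (T *m G) i l * (H l j)%:P.
  have /matrixP/(_ i j) : (T *m G) *m map_mx polyC H = 'X^m *: T.
    by rewrite -mulmxA GH mul_mx_scalar.
  by rewrite [RHS]mxE mxE => <-; apply: eq_bigr => l' _; rewrite [map_mx _ _ _ _]mxE.
move/(congr1 (size \o polyseq)) => /= /eqP; apply/negP; rewrite neq_ltn; apply/orP; right.
rewrite size_mul ?(monic_neq0 (monicXn _ _)) // size_polyXn addSn.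
rewrite (@leq_ltn_trans m) //; last first.
  by rewrite -addn1 leq_add2l size_poly_gt0.
rewrite (leq_trans (size_sum _ _ _)) //; apply/bigmax_leqP => l' _.
rewrite (leq_trans (size_polyMleq _ _)) // -subn1 leq_subLR addnC.
by rewrite leq_add // size_polyC leq_b1.
Qed.

(** The lower bound is [row_degree_mul_ge] for the identity matrix. *)
Lemma row_degreeE i : row_degree G i = m.
Proof.
apply/eqP; rewrite eqn_leq -{2}(mul1mx G) row_degree_mul_ge ?andbT.
  by apply/bigmax_leqP => j _; rewrite -subn1 leq_subLR add1n.
by apply/rV0Pn; exists i; rewrite !mxE eqxx oner_eq0.
Qed.

Hypothesis G_inv : right_invertible G.

Lemma minimal_mx_top : minimal_mx G.
Proof.
split; first exact: right_invertible_rank.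
by rewrite max_minor_degreeE (eq_bigr _ (fun i _ => row_degreeE i)) sum_nat_const card_ord.
Qed.

Lemma forney_indices_top : forney_indices (mx_im G) (nseq k m).
Proof.
exists k, G; split=> //; first exact: minimal_mx_top.
by rewrite (map_eq_const _ row_degreeE) size_enum_ord.
Qed.

(** Another minimal generator matrix is [T *m G] with [T] invertible. Its minors change only by the
    constant [\det T], so its row degrees add up to [k * m]; each is at least [m], so all equal
    [m]. *)
Lemma forney_indices_unique s : forney_indices (mx_im G) s -> s = nseq k m.
Proof.
move=> [l [G' [[rk_G' minor_G'] im_G' s_perm]]].
have eq_kl : l = k.
  rewrite -rk_G' -(right_invertible_rank G_inv); apply/eqP.
  by rewrite eqn_leq !mx_im_rank_le // => w /im_G'.
subst l; have [T G'E] := mx_im_sub (fun w => (im_G' w).2).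
have [T' GE] := mx_im_sub (fun w => (im_G' w).1).
(* Here [T' *m T *m G = G], and the right inverse of [G] cancels [G]. *)
have TT : T' *m T = 1%:M.
  have [H0 GH0] := G_inv.
  by rewrite -[T' *m T]mulmx1 -GH0 mulmxA -(mulmxA T') -G'E -GE.
have det_T : size (\det T) = 1%N.
  apply/eqP; rewrite -dvdp1; apply/dvdpP; exists (\det T').
  by rewrite -det_mulmx TT det1.
have minor_eq : max_minor_degree G' = (k * m)%N.
  rewrite -max_minor_degreeE; apply: eq_bigr => f _.
  have detT_neq0 : \det T != 0 by rewrite -size_poly_gt0 det_T.
  rewrite G'E -mulmx_colsub det_mulmx; have [->|neq0] := eqVneq (\det (colsub f G)) 0.
    by rewrite mulr0.
  by rewrite size_mul // det_T.
have T_row i : row i T != 0.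
  apply: contraTneq isT => Ti0; have /(congr1 (row i)) := mulmx1C TT.
  by rewrite row_mul Ti0 mul0mx => /rowP/(_ i)/eqP; rewrite !mxE eqxx eq_sym oner_eq0.
have deg_ge i : (m <= row_degree G' i)%N by rewrite G'E row_degree_mul_ge.
have deg_eq i : row_degree G' i = m.
  have := leqif_sum (fun i (_ : true) => leqif_eq (deg_ge i)).
  rewrite -minor_G' minor_eq sum_nat_const card_ord => -[_].
  by rewrite eqxx => /esym/forallP/(_ i)/eqP.
move: s_perm; rewrite (map_eq_const _ deg_eq) size_enum_ord => s_perm.
rewrite -(size_nseq k m) -(perm_size s_perm); apply/all_pred1P.
by rewrite (perm_all _ s_perm) all_pred1_nseq.
Qed.

End ConstantLeadingInverse.

(** * A basis of a principal ideal of the cyclic algebra *)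

Section CyclicIdeal.

Variables (F : finFieldType) (n : nat).
Hypothesis n_gt0 : (0 < n)%N.

Local Notation A := (cyc_alg F n).
Local Notation x := ('qX : A).

Lemma cyc_alg_sum (a : A) : a = \sum_(j < n) vmap0 a 0 j *: x ^+ j.
Proof. exact/esym/vmap0K. Qed.

Lemma cyc_alg_sum_linear (phi : {scalar A}) (a d : A) :
  \sum_(j < n) vmap0 a 0 j * phi (x ^+ j * d) = phi (a * d).
Proof.
rewrite [in RHS](cyc_alg_sum a) mulr_suml linear_sum; apply: eq_bigr => j _.
by rewrite -scalerAl linearZ.
Qed.

Variable c : A.

Let ideal := limg (linfun (fun a : A => a * c)).

Lemma mem_ideal (v : A) : reflect (exists a, v = a * c) (v \in ideal).
Proof.
have mulE a : linfun (fun a : A => a * c) a = a * c.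
  exact: (lfunE (c \o* idfun : {linear A -> A})).
apply: (iffP memv_imgP) => [[a _ ->]|[a ->]]; exists a; rewrite ?memvf //.
Qed.

Lemma principal_ideal_dim_gt0 : c != 0 -> (0 < principal_ideal_dim c)%N.
Proof.
have c_in : c \in ideal by apply/mem_ideal; exists 1; rewrite mul1r.
by rewrite lt0n dimv_eq0; apply: contraNneq => ideal0; rewrite -memv0 -ideal0.
Qed.

Let powers d := mkseq (fun i => x ^+ i * c) d.

Let powers_sub d : (<<powers d>> <= ideal)%VS.
Proof. by apply/span_subvP => _ /mapP[i _ ->]; apply/mem_ideal; exists (x ^+ i). Qed.

Let mem_powers d i : (i < d)%N -> x ^+ i * c \in <<powers d>>%VS.
Proof. by move=> lt_id; apply/memv_span/map_f; rewrite mem_iota. Qed.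

(** Once [x ^+ d * c] depends on the lower powers, their span is closed under multiplication by [x],
    hence contains every [x ^+ j * c]. *)
Let powers_stable d : x ^+ d * c \in <<powers d>>%VS -> (ideal <= <<powers d>>)%VS.
Proof.
move=> xd_in; have pow_in j : x ^+ j * c \in <<powers d>>%VS.
  elim: j => [|j IH].
    (* For [d = 0] the hypothesis is itself the base case. *)
    by case: (posnP d) => [d0|/mem_powers//]; move: xd_in; rewrite {1}d0.
  rewrite exprS -mulrA (coord_span (X := in_tuple (powers d)) IH) mulr_sumr.
  apply: memv_suml => i _; rewrite -scalerAr memvZ // /powers.
  have lt_id : (i < d)%N by rewrite -[d in X in (_ < X)%N](size_mkseq (fun i => x ^+ i * c)).
  rewrite nth_mkseq // mulrA -exprS.
  by move: lt_id; rewrite leq_eqVlt => /orP[/eqP ->//|/mem_powers].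
apply/subvP => v /mem_ideal[a ->]; rewrite (cyc_alg_sum a) mulr_suml.
by apply: memv_suml => j _; rewrite -scalerAl memvZ.
Qed.

Let powers_dim d : (d <= \dim <<powers d>>)%N \/ (ideal <= <<powers d>>)%VS.
Proof.
elim: d => [|d IH]; first by left.
have sub_d : (<<powers d>> <= <<powers d.+1>>)%VS.
  by rewrite /powers mkseqS -cats1 span_cat addvSl.
case: IH => [le_d|/subv_trans]; last by move/(_ _ sub_d); right.
have [|xd_notin] := boolP (x ^+ d * c \in <<powers d>>%VS).
  by move/powers_stable/subv_trans => /(_ _ sub_d); right.
left; apply: (leq_ltn_trans le_d); rewrite ltnNge; apply: contraNN xd_notin => le_dim.
suff /eqP -> : <<powers d>>%VS == <<powers d.+1>>%VS by rewrite mem_powers.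
by rewrite eqEdim sub_d.
Qed.

Definition power_basis : (principal_ideal_dim c).-tuple A :=
  [tuple x ^+ i * c | i < principal_ideal_dim c].

Lemma nth_power_basis (i : 'I_(principal_ideal_dim c)) : power_basis`_i = x ^+ i * c.
Proof. by rewrite -tnth_nth tnth_mktuple. Qed.

(* In a cyclic module the iterates of the generator span once they stop being
   independent, so the first \dim of them form a basis. *)
Lemma power_basisP : basis_of ideal power_basis.
Proof.
have -> : tval power_basis = powers (\dim ideal).
  by rewrite /powers /mkseq -val_enum_ord -map_comp.
set k := \dim ideal.
have full : <<powers k>>%VS = ideal.
  (* Either alternative of [powers_dim] bounds the dimension of the span below by [k]. *)
  apply/eqP; rewrite eqEdim powers_sub; case: (powers_dim k) => //; exact: dimvS.
by rewrite /basis_of /free full eqxx size_mkseq eqxx.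
Qed.

End CyclicIdeal.

(** * The encoder, its block inverses and its image *)

Section CyclicEncoder.

Variables (F : finFieldType) (n : nat).
Hypothesis n_gt0 : (0 < n)%N.

Local Notation A := (cyc_alg F n).
Local Notation x := ('qX : A).

Variable sigma : {lrmorphism A -> A}.
Hypothesis sigma_inj : injective sigma.

Local Notation "a ^[ j ]" := (iter j sigma a) (at level 2, format "a ^[ j ]").

Variables (c : A) (m : nat).
Hypothesis c_idem : c * c = c.
Hypothesis c_orth : forall j, (1 <= j <= m)%N -> c * c^[j] = 0.

Local Notation k := (principal_ideal_dim c).

Definition coef_block (nu : nat) : 'M[F]_(k, n) :=
  \matrix_(i < k) vmap0 (x ^+ i * c)^[nu].

Definition encoder : 'M[{poly F}]_(k, n) :=
  \sum_(nu < m.+1) 'X^nu *: map_mx polyC (coef_block nu).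

Definition shifted_basis mu : k.-tuple A := map_tuple (iter mu sigma) (power_basis c).

(** Multiplication by [c^[mu]] followed by coordinates, written as a matrix on the monomials
    [x ^+ j]. *)
Definition block_inverse mu : 'M[F]_(n, k) :=
  \matrix_(j, i) coord (shifted_basis mu) i (x ^+ j * c^[mu]).

Lemma iter_sigmaZ mu (a : F) (y : A) : (a *: y)^[mu] = a *: y^[mu].
Proof. by elim: mu => //= mu ->; rewrite linearZ. Qed.

Lemma nth_shifted_basis mu (i : 'I_k) : (shifted_basis mu)`_i = (x ^+ i * c)^[mu].
Proof. by rewrite (nth_map 0) ?size_tuple // nth_power_basis. Qed.

(** A linear relation pulls back along the injective linear map [iter mu sigma] to one between the
    elements of [power_basis]. *)
Lemma shifted_basis_free mu : free (shifted_basis mu).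
Proof.
apply/freeP => a; under eq_bigr do rewrite nth_shifted_basis -iter_sigmaZ.
have iter_inj : injective (iter mu sigma) by elim: mu => //= mu IH y z /sigma_inj/IH.
rewrite -iter_sigma_sum -[RHS](iter_sigma0 sigma mu) => /iter_inj.
under eq_bigr do rewrite -nth_power_basis.
exact/freeP/(basis_free (power_basisP n_gt0 c)).
Qed.

Lemma shifted_mul nu mu i : (nu <= m)%N -> (mu <= m)%N ->
  (x ^+ i * c)^[nu] * c^[mu] = if nu == mu then (x ^+ i * c)^[nu] else 0.
Proof.
move=> le_nu le_mu; have [<-|neq] := eqVneq nu mu.
  by rewrite -iter_sigmaM -mulrA c_idem.
rewrite iter_sigmaM -mulrA; have [lt|lt|eq] := ltngtP nu mu; last by rewrite eq eqxx in neq.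
  by rewrite (iter_orth c_orth) ?mulr0 // lt (leq_trans le_mu) ?leq_addl.
by rewrite [_ * c^[mu]]mulrC (iter_orth c_orth) ?mulr0 // lt (leq_trans le_nu) ?leq_addl.
Qed.

Lemma coef_block_mul nu mu : (nu <= m)%N -> (mu <= m)%N ->
  coef_block nu *m block_inverse mu = if nu == mu then 1%:M else 0.
Proof.
move=> le_nu le_mu; apply/matrixP => i l; rewrite mxE.
under eq_bigr do rewrite !mxE.
(* By linearity the sum over monomials is one coordinate of a product that [shifted_mul] evaluates
   to a basis vector or 0. *)
transitivity (coord (shifted_basis mu) l ((x ^+ i * c)^[nu] * c^[mu])).
  rewrite -[RHS](cyc_alg_sum_linear n_gt0 (coord (shifted_basis mu) l : {scalar A})).
  by apply: eq_bigr => j _; rewrite mxE.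
rewrite (shifted_mul i le_nu le_mu); have [<-|neq] := eqVneq nu mu; last first.
  by rewrite linear0 mxE.
rewrite mxE -nth_shifted_basis.
exact: (coord_free i l (shifted_basis_free nu)).
Qed.

Lemma encoder_mul mu : (mu <= m)%N ->
  encoder *m map_mx polyC (block_inverse mu) = 'X^mu%:M.
Proof.
move=> le_mu; rewrite mulmx_suml.
have term (nu : nat) : (nu <= m)%N ->
    ('X^nu *: map_mx polyC (coef_block nu)) *m map_mx polyC (block_inverse mu)
      = 'X^nu *: (if nu == mu then 1%:M else 0).
  move=> le_nu; rewrite -scalemxAl -map_mxM coef_block_mul //.
  by case: eqP; rewrite ?map_mx1 ?map_mx0.
rewrite (bigD1 (Ordinal (le_mu : (mu < m.+1)%N))) //= term // eqxx scalemx1.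
rewrite big1 ?addr0 // => nu neq. rewrite term -1?ltnS //.
by move: neq; rewrite -val_eqE => /negPf /= ->; rewrite scaler0.
Qed.

Lemma encoder_right_inverse : right_invertible encoder.
Proof. by exists (map_mx polyC (block_inverse 0)); rewrite encoder_mul. Qed.

Lemma coef_encoder i q j :
  (encoder i q)`_j = if (j <= m)%N then coef_block j i q else 0.
Proof.
have term (nu : nat) : (('X^nu *: map_mx polyC (coef_block nu)) i q)`_j
    = if j == nu then coef_block nu i q else 0.
  by rewrite !mxE coefMC coefXn; case: eqP; rewrite ?mul1r ?mul0r.
rewrite summxE coef_sum; under eq_bigr do rewrite term.
rewrite -big_mkcond /=; case: leqP => [le_jm|lt_mj].
  rewrite (bigD1 (Ordinal (le_jm : (j < m.+1)%N))) //= big1 ?addr0 // => nu.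
  by rewrite -val_eqE eq_sym => /andP[/= ->].
rewrite big1 // => nu /eqP eq_j; have := ltn_ord nu.
by rewrite -eq_j ltnS leqNgt lt_mj.
Qed.

Lemma size_encoder i q : (size (encoder i q) <= m.+1)%N.
Proof. by apply/leq_sizeP => j lt_mj; rewrite coef_encoder leqNgt lt_mj. Qed.

Let g : skew_poly sigma := skewC sigma c * \sum_(nu < m.+1) skewX sigma ^+ nu.

Lemma coef_geom j : skew_coef g j = if (j <= m)%N then c^[j] else 0.
Proof.
rewrite /g skew_geomE.
rewrite (big_morph (fun f : skew_poly sigma => skew_coef f j)
  (fun f h => skew_coefD f h j) (skew_coef0 _ j)).
case: leqP => [le_jm|lt_mj].
  rewrite (bigD1 (Ordinal (le_jm : (j < m.+1)%N))) //= big1 => [|nu neq].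
    by rewrite skew_coefXnM ltnn subnn skew_coefC addr0.
  rewrite skew_coefXnM skew_coefC subn_eq0; case: ltnP => // le_nuj.
  by move: neq; rewrite -val_eqE /= eqn_leq le_nuj /= => /negPf ->.
rewrite big1 // => nu _; rewrite skew_coefXnM skew_coefC subn_eq0.
by rewrite [(j <= nu)%N]leqNgt (leq_ltn_trans _ lt_mj) ?if_same // -ltnS.
Qed.

(** The coefficients of [g] are iterates of [c], so [f * g] depends on the coefficients of [f] only
    through their products with [c]; the hypothesis says that [u] lists the coordinates of these. *)
Lemma vmap_mul_geom (u : 'rV[{poly F}]_k) (f : skew_poly sigma) :
    (forall nu, skew_coef f nu * c = \sum_(i < k) (u 0 i)`_nu *: (x ^+ i * c)) ->
  u *m encoder = vmap (f * g).
Proof.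
move=> uf; apply/rowP => q; apply/polyP => l.
rewrite coef_vmap skew_coefM mxE coef_sum.
have term (j : 'I_l.+1) : (skew_coef f (l - j))^[j] * skew_coef g j
    = \sum_(i < k) (if (j <= m)%N then (u 0 i)`_(l - j) else 0) *: (x ^+ i * c)^[j].
  rewrite coef_geom; case: ifP => _; last first.
    by rewrite mulr0 big1 // => i _; rewrite scale0r.
  rewrite -iter_sigmaM uf iter_sigma_sum; apply: eq_bigr => i _.
  by rewrite iter_sigmaZ.
under [in RHS]eq_bigr do rewrite term.
rewrite mxE raddf_sum /= coef_sum.
under eq_bigr do rewrite coefMr.
rewrite exchange_big /=; apply: eq_bigr => j _.
rewrite raddf_sum /= coef_sum; apply: eq_bigr => i _.
by rewrite coef_encoder coefZ mxE; case: ifP => _; rewrite ?mulr0 ?mul0r // mxE.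
Qed.

Lemma encoder_image w : mx_im encoder w <-> exists f : skew_poly sigma, w = vmap (f * g).
Proof.
split=> [[u ->]|[f ->]].
  pose N := \max_(i < k) size (u 0%R i).
  (* The entries of [u] are read as coordinates along the [x ^+ i]; from index [N] on they all
     vanish. *)
  exists (\poly_(nu < N) (\sum_(i < k) (u 0 i)`_nu *: x ^+ i) : {poly A}).
  apply: vmap_mul_geom => nu; rewrite /skew_coef coef_poly; case: ltnP => [_|le_N].
    by rewrite mulr_suml; apply: eq_bigr => i _; rewrite -scalerAl.
  rewrite mul0r big1 // => i _; rewrite nth_default ?scale0r // (leq_trans _ le_N) //.
  exact: (leq_bigmax (F := fun i => size (u 0 i))).
pose B := power_basis c.
(* Conversely, each product of a coefficient of [f] with [c] lies in the ideal and is expanded in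
   the power basis. *)
exists (\row_i \poly_(nu < size (f : {poly A})) coord B i (skew_coef f nu * c)).
apply/esym/vmap_mul_geom => nu.
have in_span : skew_coef f nu * c \in <<B>>%VS.
  by rewrite (span_basis (power_basisP n_gt0 c)); apply/mem_ideal; exists (skew_coef f nu).
rewrite {1}(coord_span in_span); apply: eq_bigr => i _.
rewrite nth_power_basis mxE coef_poly; case: ltnP => // le_f.
by rewrite /skew_coef nth_default // mul0r linear0.
Qed.

Lemma encoder_sigma_cyclic : sigma_cyclic sigma (mx_im encoder).
Proof.
split; first exact: mx_im_submodule.
have memP (f : skew_poly sigma) :
    (exists2 v, mx_im encoder v & f = Defs.pmap sigma v) <-> exists h, f = h * g.
  split=> [[v /encoder_image[h ->] ->]|[h ->]]; first by exists h; rewrite vmapK.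
  by exists (vmap (h * g)); rewrite ?vmapK //; apply/encoder_image; exists h.
split=> [|f h /memP[f' ->] /memP[h' ->]|a f /memP[f' ->]]; apply/memP.
- by exists 0; rewrite mul0r.
- by exists (f' + h'); rewrite mulrDl.
- by exists (a * f'); rewrite mulrA.
Qed.

End CyclicEncoder.

(** * Orthogonality of a sum of primitive idempotents and its iterates *)

Section OrthogonalIterates.

Variables (F : finFieldType) (n : nat).
Hypothesis n_gt0 : (0 < n)%N.

Local Notation A := (cyc_alg F n).

Variables (sigma : {rmorphism A -> A}) (r : nat).
Variables (ppi : 'I_r -> {poly F}) (eps : 'I_r -> A) (S : {set A}).
Hypothesis sigma_bij : bijective sigma.
Hypothesis eps_prim : primitive_idempotents ppi eps.
Hypothesis S_sub : S \subset [set eps i | i : 'I_r].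

Let S_primitive e : e \in S -> primitive_idempotent e.
Proof. by move/(subsetP S_sub)/imsetP=> [i _ ->]; exact: (eps_primitive n_gt0 eps_prim). Qed.

Let iter_primitive j e : e \in S -> primitive_idempotent (iter j sigma e).
Proof.
by move=> e_S; elim: j => [|j IH] /=; [apply: S_primitive | apply: primitive_morph].
Qed.

Lemma mul_sum_primitive e : e \in S -> e * (\sum_(e' in S) e') = e.
Proof.
move=> e_S; rewrite mulr_sumr (bigD1 e) //= (S_primitive e_S).1.
rewrite big1 ?addr0 // => e' /andP[e'_S neq].
by apply: primitive_orthogonal; [exact: S_primitive.. | exact/nesym/eqP].
Qed.

Lemma sum_primitive_idem : (\sum_(e in S) e) * (\sum_(e in S) e) = \sum_(e in S) e.
Proof. by rewrite mulr_suml; apply: eq_bigr => e; exact: mul_sum_primitive. Qed.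

Lemma sum_primitive_neq0 : S != set0 -> \sum_(e in S) e != 0.
Proof.
case/set0Pn=> e e_S; apply/eqP => c0; have := mul_sum_primitive e_S.
rewrite c0 mulr0; have /imsetP[i _ ->] := subsetP S_sub _ e_S.
by move/esym/(eps_neq0 eps_prim).
Qed.

(** Disjointness makes every [e] in [S] differ from every [iter j sigma e']; both are primitive, so
    all products in the expansion vanish. *)
Lemma sum_primitive_orth j : S :&: [set iter j sigma e | e in S] = set0 ->
  (\sum_(e in S) e) * iter j sigma (\sum_(e in S) e) = 0.
Proof.
move=> disj; rewrite iter_sigma_sum mulr_suml big1 // => e e_S.
rewrite mulr_sumr big1 // => e' e'_S; apply: primitive_orthogonal.
- exact: S_primitive.
- exact: iter_primitive.
by move=> eq_e; move/setP/(_ e): disj; rewrite !inE e_S {1}eq_e imset_f.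
Qed.

End OrthogonalIterates.

Theorem theorem3p3 (F : finFieldType) (n : nat)
    (n_gt0 : (0 < n)%N)
    (char_n : forall p : nat, p \in [pchar F] -> ~~ (p %| n)%N)
    (sigma : {lrmorphism cyc_alg F n -> cyc_alg F n})
    (sigma_bij : bijective sigma)
    (r : nat) (ppi : 'I_r -> {poly F}) (eps : 'I_r -> cyc_alg F n)
    (eps_prim : primitive_idempotents ppi eps)
    (S : {set cyc_alg F n})
    (S_sub : S \subset [set eps i | i : 'I_r])
    (S_neq0 : S != set0)
    (b : nat) (b_gt0 : (1 <= b)%N)
    (S_disj : forall j : nat, (1 <= j <= b)%N ->
       S :&: [set iter j sigma e | e in S] = set0)
    (m : nat) (m_bounds : (1 <= m <= b)%N) :
  let c : cyc_alg F n := \sum_(e in S) e in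
  let x : cyc_alg F n := 'qX in
  let k : nat := principal_ideal_dim c in
  let z : skew_poly sigma := skewX sigma in
  let C_ (a : cyc_alg F n) : skew_poly sigma := skewC sigma a in
  let g : skew_poly sigma := C_ c * \sum_(nu < m.+1) z ^+ nu in
  let G_ (nu : nat) : 'M[F]_(k, n) :=
    \matrix_(i < k) vmap0 (iter nu sigma (x ^+ i * c)) in
  let G : 'M[{poly F}]_(k, n) :=
    \sum_(nu < m.+1) 'X^nu *: map_mx polyC (G_ nu) in
  let C : 'rV[{poly F}]_n -> Prop := mx_im G in
  let u : skew_poly sigma :=
    \prod_(0 <= j < m) (1 - z * C_ (iter (m - j) sigma c)) in
  g = \sum_(nu < m.+1) z ^+ nu * C_ (iter nu sigma c) /\
  (* (a) *)
  g = C_ c * \prod_(1 <= j < m.+1) (1 + z * C_ (iter j sigma c)) /\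
  (* (b) *)
  [/\ g * u = C_ c, two_sided_unit u
    & u = 1 - z * C_ (\sum_(1 <= j < m.+1) iter j sigma c)] /\
  (* (c) *)
  [/\ forall w, C w <-> exists f : skew_poly sigma, w = vmap (f * g),
      sigma_cyclic sigma C
    & free_rank C k] /\
  (* (d) *)
  [/\ sigma_cyclic sigma C, direct_summand C & right_invertible G] /\
  (* (e) *)
  minimal_mx G /\
  (* (f) *)
  [/\ conv_code k (k * m) C, has_memory C m
    & forall s, forney_indices C s -> s = nseq k m].
Proof.
move=> c x k z C_ g G_ G C u.
case/andP: m_bounds => m_gt0 le_mb.
have c_idem : c * c = c := sum_primitive_idem n_gt0 eps_prim S_sub.
have c_orth j : (1 <= j <= m)%N -> c * iter j sigma c = 0.
  case/andP=> j_gt0 le_jm.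
  apply: (sum_primitive_orth n_gt0 sigma_bij eps_prim S_sub).
  by apply: S_disj; rewrite j_gt0 (leq_trans le_jm).
have sigma_inj := bij_inj sigma_bij.
have gE : g = C_ c * \prod_(1 <= j < m.+1) (1 + z * C_ (iter j sigma c)).
  by rewrite -(skew_geom_prod c_idem c_orth) // -skew_geomE.
have [vu uv] := skew_prod_inv c_orth (leqnn m).
have G_inv : right_invertible G := encoder_right_inverse n_gt0 sigma_inj c_idem c_orth.
have GH := encoder_mul n_gt0 sigma_inj c_idem c_orth (leqnn m).
have szG i q : (size (G i q) <= m.+1)%N by exact: size_encoder.
have C_cyclic : sigma_cyclic sigma C := encoder_sigma_cyclic n_gt0 sigma c m.
have G_min : minimal_mx G := minimal_mx_top szG GH G_inv.
(* The memory is a maximum over [k] copies of [m], and an empty maximum would be 0. *)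
have k_gt0 : (0 < k)%N.
  exact/principal_ideal_dim_gt0/(sum_primitive_neq0 n_gt0 eps_prim).
split; first exact: skew_geomE.
split; first exact: gE.
split.
  split; [by rewrite gE -mulrA vu mulr1 | | exact: (skew_prod_sum c_orth (leqnn m))].
  exists (\prod_(1 <= j < m.+1) (1 + z * C_ (iter j sigma c))).
  by split; [exact: uv | exact: vu].
split.
  split=> //; first exact: encoder_image.
  by exists G; split=> //; exact: right_invertible_inj.
split; first by split=> //; exact: right_invertible_summand.
split; first exact: G_min.
split.
- by exists G; split=> //; exact: (max_minor_degreeE szG GH).
- exists (nseq k m); first exact: (forney_indices_top szG GH G_inv).
  by rewrite big_nseq; case: (k) k_gt0 => // k' _; elim: k' => //= k' <-; rewrite maxnn.
- exact: (forney_indices_unique szG GH G_inv).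
Qed.
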